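(* Let $A \in M_{2n\times 2n}(\mathbb{C})$ be a normal matrix that is per-Hermitian or perskew-Hermitian. Then $A$ is perplectic diagonalizable if and only if it is unitary-perplectic diagonalizable.
   Context: $M_{2n\times 2n}(\mathbb{C})$ is the space of complex $2n\times 2n$ matrices and $A^H=\overline{A}^T$ is the Hermitian transpose. $A$ is normal if $A^HA=AA^H$. $R_n$ is the $n\times n$ matrix with ones on the antidiagonal and zeros elsewhere, and $R_{2n} = \begin{bmatrix} 0 & R_n \\ R_n & 0\end{bmatrix}$. A matrix $A$ is per-Hermitian if $R_{2n} A^H R_{2n} = A$, and perskew-Hermitian if $R_{2n} A^H R_{2n} = -A$. A matrix $S \in M_{2n\times 2n}(\mathbb{C})$ is perplectic if $S^H R_{2n} S = R_{2n}$, and unitary-perplectic if it is both unitary and perplectic. $A$ is perplectic diagonalizable (respectively unitary-perplectic diagonalizable) if there is a perplectic (respectively unitary-perplectic) matrix $S$ such that $S^{-1}AS$ is diagonal. *)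

(* Defs.v *)
From mathcomp Require Import all_boot all_order all_algebra.
From mathcomp Require Import spectral complex reals.

Set Implicit Arguments.
Unset Strict Implicit.
Unset Printing Implicit Defensive.

Import GRing.Theory Num.Theory.
Local Open Scope ring_scope.
Local Open Scope sesquilinear_scope.

(* With C = R[i] and R : realType, A ^t* is the Hermitian transpose A^H;
   normal and unitary matrices are normalmx and unitarymx from spectral. *)

Section Perplectic.
Variables (R : realType) (n : nat).
Local Notation C := R[i].
Implicit Types A S : 'M[C]_(n + n).

Definition antidiag : 'M[C]_n := \matrix_(i, j) (j == rev_ord i)%:R.

Definition antidiag2 : 'M[C]_(n + n) := block_mx 0 antidiag antidiag 0.

Definition perhermitian A := antidiag2 *m A ^t* *m antidiag2 = A.

Definition perskewhermitian A := antidiag2 *m A ^t* *m antidiag2 = - A.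

Definition perplectic S := S ^t* *m antidiag2 *m S = antidiag2.

Definition unitary_perplectic S := S \is unitarymx /\ perplectic S.

(* A perplectic matrix is automatically invertible, so invmx is the genuine
   inverse in the two definitions below. *)
Definition perplectic_diagonalizable A :=
  exists S, perplectic S /\ is_diag_mx (invmx S *m A *m S).

Definition unitary_perplectic_diagonalizable A :=
  exists S, unitary_perplectic S /\ is_diag_mx (invmx S *m A *m S).

End Perplectic.

(* Main.v *)
Require Import Defs.
From mathcomp Require Import all_boot all_order all_algebra.
From mathcomp Require Import spectral complex reals.

(** Polar decomposition preserves diagonalization. Write A S = S D with S
    perplectic and D diagonal, and S = U P with P = sqrt (S^H S). As A and D
    are normal, Fuglede gives A^H S = S D^H, so S^H S commutes with D, and so
    does P; hence A U = U D. Moreover H = S^H S satisfies H J H = J for the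
    flip J, which passes to the square root as P J P = J, so that
    U = S P^-1 is perplectic. *)

Set Implicit Arguments.
Unset Strict Implicit.
Unset Printing Implicit Defensive.

Import Order.TTheory GRing.Theory Num.Theory.
Local Open Scope ring_scope.
Local Open Scope sesquilinear_scope.

Section FunctionalCalculus.
Variables (C : numClosedFieldType) (n : nat).
Implicit Types A B S T : 'M[C]_n.

(* Meaningful for normal [A] only: [spectral_diag A] is [0] otherwise. *)
Definition funmx (f : C -> C) A : 'M[C]_n :=
  (spectralmx A)^t* *m diag_mx (map_mx f (spectral_diag A)) *m spectralmx A.

Lemma spectralmxK A : spectralmx A *m (spectralmx A)^t* = 1%:M.
Proof. exact/unitarymxP/spectral_unitarymx. Qed.

Lemma spectralmxKV A : (spectralmx A)^t* *m spectralmx A = 1%:M.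
Proof. exact/mulmx1C/spectralmxK. Qed.

Lemma normalmx_spectral A : A \is normalmx ->
  A = (spectralmx A)^t* *m diag_mx (spectral_diag A) *m spectralmx A.
Proof.
by move=> /orthomx_spectralP {1}->; rewrite invmx_unitary // spectral_unitarymx.
Qed.

Lemma spectral_diagE A : A \is normalmx ->
  diag_mx (spectral_diag A) = spectralmx A *m A *m (spectralmx A)^t*.
Proof.
move=> nA; have VV := spectralmxK A; have := normalmx_spectral nA.
set V := spectralmx A in VV *; move: (spectral_diag A) => d ->.
by rewrite !mulmxA VV mul1mx -mulmxA VV mulmx1.
Qed.

(** Only the values on the spectrum enter, so sign conditions on the eigenvalues can be used to
    compare [f] and [g]. *)
Lemma eq_funmx f g A :
  (forall i, f (spectral_diag A 0 i) = g (spectral_diag A 0 i)) ->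
  funmx f A = funmx g A.
Proof.
move=> fg; congr (_ *m diag_mx _ *m _).
by apply/rowP => i; rewrite !mxE fg.
Qed.

Lemma funmx_id A : A \is normalmx -> funmx id A = A.
Proof.
by move=> nA; rewrite /funmx (@map_mx_id _ _ _ id) // -normalmx_spectral.
Qed.

Lemma funmxM f g A :
  funmx f A *m funmx g A = funmx (fun x => f x * g x) A.
Proof.
rewrite /funmx !mulmxA -(mulmxA _ (spectralmx A)) spectralmxK mulmx1.
rewrite -(mulmxA ((spectralmx A)^t*)) mulmx_diag.
by congr (_ *m diag_mx _ *m _); apply/rowP => i; rewrite !mxE.
Qed.

Lemma funmx_adj f A : (funmx f A)^t* = funmx (fun x => (f x)^*) A.
Proof.
rewrite /funmx !trmx_mul !map_mxM /= trmxCK tr_diag_mx map_diag_mx mulmxA.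
by rewrite -map_mx_comp.
Qed.

Lemma funmx_conj A : A \is normalmx -> funmx Num.conj A = A^t*.
Proof. by move=> nA; rewrite -(funmx_adj id) funmx_id. Qed.

(* In eigenbases the hypothesis reads (a_i - b_j) T_ij = 0. *)
Lemma funmx_intertwine f A B T : A \is normalmx -> B \is normalmx ->
  A *m T = T *m B -> funmx f A *m T = T *m funmx f B.
Proof.
move=> nA nB AT.
pose V := spectralmx A; pose W := spectralmx B; pose K := V *m T *m W^t*.
have dK : diag_mx (spectral_diag A) *m K = K *m diag_mx (spectral_diag B).
  rewrite !spectral_diagE // -/V -/W /K !mulmxA.
  rewrite -(mulmxA _ (V^t*)) spectralmxKV mulmx1.
  rewrite -(mulmxA _ (W^t*)) spectralmxKV mulmx1.
  by rewrite -(mulmxA V A) AT mulmxA.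
have fK : diag_mx (map_mx f (spectral_diag A)) *m K =
          K *m diag_mx (map_mx f (spectral_diag B)).
  apply/matrixP => i j; move/matrixP/(_ i j): dK.
  rewrite !mul_diag_mx !mul_mx_diag.
  do !rewrite [fun_of_matrix (\matrix_(_, _) _) _ _]mxE.
  rewrite ![map_mx _ _ _ _]mxE.
  (* A nonzero entry of [K] forces the two eigenvalues to agree, hence also their images under
     [f]. *)
  have [->|Kn0] := eqVneq (K i j) 0; first by rewrite !mulr0 !mul0r.
  by rewrite mulrC => /(mulfI Kn0) ->; rewrite mulrC.
have TE : T = V^t* *m K *m W.
  by rewrite /K !mulmxA spectralmxKV mul1mx -mulmxA spectralmxKV mulmx1.
clearbody K; rewrite [in LHS]TE [in RHS]TE /funmx -/V -/W !mulmxA.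
rewrite -(mulmxA _ V) spectralmxK mulmx1.
rewrite -(mulmxA _ W (W^t*)) spectralmxK mulmx1.
by rewrite -(mulmxA _ _ K) fK mulmxA.
Qed.

(** The adjoint of a normal matrix is its image under complex conjugation of the spectrum, so this
    is an instance of [funmx_intertwine]. *)
Lemma fuglede A B T : A \is normalmx -> B \is normalmx ->
  A *m T = T *m B -> A^t* *m T = T *m B^t*.
Proof.
by move=> nA nB /(funmx_intertwine Num.conj nA nB); rewrite !funmx_conj.
Qed.

Lemma gram_normalmx S : S^t* *m S \is normalmx.
Proof. by apply/normalmxP; rewrite trmx_mul map_mxM trmxCK. Qed.

(** Each eigenvalue is a diagonal entry of M M^H with M = V S^H, that is, the squared norm of a row
    of M. *)
Lemma gram_spectral_ge0 S i : 0 <= spectral_diag (S^t* *m S) 0 i.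
Proof.
pose V := spectralmx (S^t* *m S).
have := spectral_diagE (gram_normalmx S); rewrite -/V.
have -> : V *m (S^t* *m S) *m V^t* = (V *m S^t*) *m (V *m S^t*)^t*.
  by rewrite trmx_mul map_mxM trmxCK !mulmxA.
move: (V *m S^t*) => M /matrixP/(_ i i); rewrite mxE eqxx mulr1n => ->.
by rewrite mxE; apply: sumr_ge0 => j _; rewrite !mxE mul_conjC_ge0.
Qed.

(** The positive semidefinite factor of the polar decomposition of [S]. *)
Definition absmx S := funmx sqrtC (S^t* *m S).

Lemma absmx_adj S : (absmx S)^t* = absmx S.
Proof.
rewrite funmx_adj; apply: eq_funmx => i.
by rewrite geC0_conj // sqrtC_ge0 gram_spectral_ge0.
Qed.

Lemma absmx_sqr S : absmx S *m absmx S = S^t* *m S.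
Proof.
rewrite funmxM -[RHS]funmx_id ?gram_normalmx //; apply: eq_funmx => i.
by rewrite -expr2 sqrtCK.
Qed.

(* In an eigenbasis the hypothesis reads h_i h_j J_ij = J_ij with h_i >= 0. *)
Lemma absmx_congr S J :
  let H := S^t* *m S in H *m J *m H = J -> absmx S *m J *m absmx S = J.
Proof.
rewrite /absmx; have := gram_spectral_ge0 S; have := gram_normalmx S.
move: (S^t* *m S) => H nH h_ge0 /= HJ.
pose V := spectralmx H; pose h := spectral_diag H; pose K := V *m J *m V^t*.
have dK : diag_mx h *m K *m diag_mx h = K.
  rewrite spectral_diagE // -/V /K !mulmxA.
  rewrite -(mulmxA _ (V^t*)) spectralmxKV mulmx1.
  rewrite -(mulmxA _ (V^t*)) spectralmxKV mulmx1.
  by rewrite -!(mulmxA V) HJ.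
have sK : diag_mx (map_mx sqrtC h) *m K *m diag_mx (map_mx sqrtC h) = K.
  apply/matrixP => i j; move/matrixP/(_ i j): dK.
  rewrite !mul_diag_mx !mul_mx_diag.
  do !rewrite [fun_of_matrix (\matrix_(_, _) _) _ _]mxE.
  rewrite ![map_mx _ _ _ _]mxE.
  have [->|Kn0] := eqVneq (K i j) 0; first by rewrite !mulr0 !mul0r.
  (* Here h_i h_j = 1, and the square root is multiplicative on nonnegative numbers. *)
  rewrite ![_ * K i j]mulrC -!mulrA -{2}[K i j]mulr1 => /(mulfI Kn0) hij.
  by rewrite -rootCMl ?h_ge0 // hij rootC1 ?mulr1.
have JE : J = V^t* *m K *m V.
  by rewrite /K !mulmxA spectralmxKV mul1mx -mulmxA spectralmxKV mulmx1.
clearbody K; rewrite {1}JE /funmx -/V -/h !mulmxA.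
rewrite -(mulmxA _ V) spectralmxK mulmx1.
rewrite -(mulmxA _ V (V^t*)) spectralmxK mulmx1.
by rewrite -!(mulmxA (V^t*)) sK [RHS]JE !mulmxA.
Qed.

Lemma diag_normalmx A : is_diag_mx A -> A \is normalmx.
Proof.
move=> /diag_mxP[d ->]; apply/normalmxP.
by rewrite tr_diag_mx map_diag_mx diag_mxC.
Qed.

End FunctionalCalculus.

Lemma antidiag2K (R : realType) n : antidiag2 R n *m antidiag2 R n = 1%:M.
Proof.
have anti2 : antidiag R n *m antidiag R n = 1%:M.
  apply/matrixP => i j; rewrite mxE (bigD1 (rev_ord i)) //= big1 => [|k ki].
    by rewrite !mxE eqxx mul1r addr0 rev_ordK eq_sym.
  by rewrite !mxE (negbTE ki) mul0r.
rewrite /antidiag2 mulmx_block !mulmx0 !mul0mx !addr0 !add0r anti2.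
by rewrite -scalar_mx_block.
Qed.

Theorem theorem6 (R : realType) (n : nat) (A : 'M[R[i]]_(n + n))
    (normalA : A \is normalmx)
    (perA : perhermitian A \/ perskewhermitian A) :
  perplectic_diagonalizable A <-> unitary_perplectic_diagonalizable A.
Proof.
split=> [[S [perS diagD]]|[S [[_ perS] diagD]]]; last by exists S.
set J := antidiag2 R n; have JJ : J *m J = 1%:M := antidiag2K R n.
have JSJS : J *m S^t* *m J *m S = 1%:M by rewrite -!mulmxA (mulmxA (S^t*)) perS.
have Sunit : S \in unitmx by case: (mulmx1_unit JSJS).
(* The left inverse J S^H J of [S] is also a right inverse, so S^H is perplectic too. *)
have SJS : S *m J *m S^t* = J.
  move/mulmx1C: JSJS; rewrite !mulmxA => /(congr1 (mulmx^~ J)) /=.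
  by rewrite -(mulmxA _ J J) JJ mulmx1 mul1mx.
have : A *m S = S *m (invmx S *m A *m S) by rewrite !mulmxA mulmxV // mul1mx.
move: (invmx S *m A *m S) diagD => D diagD AS.
have nD := diag_normalmx diagD.
set H := S^t* *m S; set P := absmx S.
have PP : P *m P = H := absmx_sqr S.
(* The adjoint of A^H S = S D^H is S^H A = D S^H, whence S^H S D = S^H A S = D S^H S. *)
have HD : H *m D = D *m H.
  rewrite /H -mulmxA -AS !mulmxA; congr (_ *m S).
  have := congr1 (fun M => M^t*) (fuglede normalA nD AS).
  by rewrite !trmx_mul !map_mxM !trmxCK.
have PD : P *m D = D *m P.
  by apply: funmx_intertwine; rewrite ?gram_normalmx.
(* H J H = S^H (S J S^H) S = S^H J S = J. *)
have PJP : P *m J *m P = J.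
  apply: absmx_congr; rewrite !mulmxA -(mulmxA _ S J) -(mulmxA _ (S *m J)) SJS.
  exact: perS.
have Punit : P \in unitmx.
  have : H \in unitmx by rewrite unitmx_mul Sunit map_unitmx unitmx_tr Sunit.
  by rewrite -PP unitmx_mul andbb.
have Qadj : (invmx P)^t* = invmx P by rewrite trmx_inv map_invmx absmx_adj.
clearbody P.
(* The unitary polar factor U = S P^-1. As P^-1 commutes with [D], A U = S D P^-1 = U D. *)
exists (S *m invmx P); split; last first.
  suff -> : invmx (S *m invmx P) *m A *m (S *m invmx P) = D by exact: diagD.
  have Uunit : S *m invmx P \in unitmx by rewrite unitmx_mul Sunit unitmx_inv.
  apply: (can_inj (mulKmx Uunit)); rewrite !mulmxA mulmxV // mul1mx AS.
  rewrite -!mulmxA; congr (S *m _); rewrite -[RHS](mulmxK Punit).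
  by rewrite -(mulmxA _ D P) -PD mulKmx.
split.
  (* U^H U = P^-1 H P^-1 = 1, since H = P P. *)
  apply/unitarymxP/mulmx1C; rewrite trmx_mul map_mxM Qadj !mulmxA.
  by rewrite -(mulmxA (invmx P)) -/H -PP mulKmx // mulmxV.
rewrite /perplectic trmx_mul map_mxM Qadj -/J !mulmxA.
(* U^H J U = P^-1 J P^-1, and J = P J P cancels both inverses. *)
rewrite -(mulmxA (invmx P)) -(mulmxA (invmx P)) perS -/J -{1}PJP.
by rewrite !mulmxA mulVmx // mul1mx mulmxK.
Qed.
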